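(* Consider the closed-loop system defined in the context, and suppose that the ac power network has a synchronization frequency $\omega_{\rm syn}\in\mathbb{R}$. Then any steady state $(\bar\theta,\bar\Omega,\bar v,\bar\lambda,\bar\zeta)$ of the system satisfies $$\begin{aligned}\dot{\bar\theta}&=\omega_{\rm syn}1_n=\omega_{\rm nom}1_n+\bar\Omega,\\ 0_n&=-\bar\Omega-mS^{-1}\bar P,\\ 0_n&=-\rho(\bar v)\bar v-\beta\Delta\boldsymbol{\tanh}(\Delta^{-1}\bar v)+[V_\star](\bar\lambda-S^{-1}\bar Q),\\ 0_n&=-k\mathcal{L}\bar\lambda-\mathcal{L}\bar\zeta+(S^{-1}\bar Q-\bar\lambda),\\ 0_n&=\mathcal{L}\bar\lambda,\end{aligned}$$ where $\bar P=f_P(\bar\theta,\bar V)$, $\bar Q=f_Q(\bar\theta,\bar V)$ and $\bar V=V_\star+\Delta\boldsymbol{\tanh}(\Delta^{-1}\bar v)$. Moreover, if there is $m_\star>0$ such that $m_i^\omega=m_\star$ for all $i$, then $$\bar\Omega=-m_\star\alpha_P1_n\ \text{ with }\ \alpha_P=\tfrac1n1_n^\top S^{-1}\bar P\in\mathbb{R},\qquad \bar\lambda=\alpha_Q1_n\ \text{ with }\ \alpha_Q=\tfrac1n1_n^\top S^{-1}\bar Q\in\mathbb{R}.$$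
   Context: **Communication graph.** $\mathcal{L}\in\mathbb{R}^{n\times n}$ is the Laplacian $\mathcal{L}=\mathcal{D}-\mathcal{A}$ of an undirected connected graph on $\{1,\dots,n\}$ with adjacency matrix $\mathcal{A}=[a_{ij}]$, where $a_{ij}=a_{ji}=1$ if $i,j$ are neighbors and $a_{ij}=a_{ji}=0$ otherwise, and $\mathcal{D}=\mathrm{diag}(\sum_j a_{ij})$. **Parameters.** $\tau_\Omega,\tau_v,\tau_p,\tau_d,\beta,k>0$ and $\omega_{\rm nom}\in\mathbb{R}$ are scalars; $m=\mathrm{diag}(m_1^\omega,\dots,m_n^\omega)$; $S=\mathrm{diag}(S_1^{\rm rated},\dots,S_n^{\rm rated})$ with $S_i^{\rm rated}>0$. For voltage limits $0<V_i^{\min}<V_i^{\max}$, put $V_i^\star=\tfrac12(V_i^{\max}+V_i^{\min})$, $\Delta_i=\tfrac12(V_i^{\max}-V_i^{\min})$, $V_\star=\mathrm{col}(V_1^\star,\dots,V_n^\star)$, $[V_\star]=\mathrm{diag}(V_1^\star,\dots,V_n^\star)$, $\Delta=\mathrm{diag}(\Delta_1,\dots,\Delta_n)$. $\boldsymbol{\tanh}$ is $\tanh$ applied entrywise; $1_n$ and $0_n$ are the all-ones and zero vectors in $\mathbb{R}^n$. $\rho(v)=\mathrm{diag}(\rho_1(v_1),\dots,\rho_n(v_n))$, where $\rho_i(v_i)=|v_i/\Delta_i|-3$ if $|v_i|>3\Delta_i$ and $\rho_i(v_i)=0$ otherwise. **Closed-loop system.** The states are $\theta,\Omega,v,\lambda,\zeta\in\mathbb{R}^n$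 and $$\begin{aligned}\dot\theta&=\omega_{\rm nom}1_n+\Omega,\\ \tau_\Omega\dot\Omega&=-\Omega-mS^{-1}P,\\ \tau_v\dot v&=-\rho(v)v-\beta\Delta\boldsymbol{\tanh}(\Delta^{-1}v)+[V_\star](\lambda-S^{-1}Q),\\ \tau_p\dot\lambda&=-k\mathcal{L}\lambda-\mathcal{L}\zeta+(S^{-1}Q-\lambda),\\ \tau_d\dot\zeta&=\mathcal{L}\lambda,\end{aligned}$$ with $V=V_\star+\Delta\boldsymbol{\tanh}(\Delta^{-1}v)$, $P=f_P(\theta,V)$, $Q=f_Q(\theta,V)$, where, for given real constants $G_{ij},B_{ij}$ and $\theta_{ij}=\theta_i-\theta_j$, the $i$-th components of $f_P$ and $f_Q$ are $$f_i^P(\theta,V)=\sum_{j=1}^nV_iV_j\big(G_{ij}\cos\theta_{ij}+B_{ij}\sin\theta_{ij}\big),\qquad f_i^Q(\theta,V)=\sum_{j=1}^nV_iV_j\big(G_{ij}\sin\theta_{ij}-B_{ij}\cos\theta_{ij}\big).$$ **Steady state.** A steady state with synchronization frequency $\omega_{\rm syn}$ is a solution along which $\dot{\bar\theta}=\omega_{\rm syn}1_n$ and all of $\bar\Omega,\bar v,\bar\lambda,\bar\zeta$ are constant in time; overbars denote steady-state values. *)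

(* Defs.v *)
From mathcomp Require Import all_boot all_order all_algebra.
From mathcomp Require Import all_classical all_reals all_analysis.

Set Implicit Arguments.
Unset Strict Implicit.
Unset Printing Implicit Defensive.

Import Order.TTheory GRing.Theory Num.Theory.
Import numFieldNormedType.Exports.

Local Open Scope classical_set_scope.
Local Open Scope ring_scope.

Definition tanh (R : realType) (x : R) : R :=
  (expR x - expR (- x)) / (expR x + expR (- x)).

(* Derivative at t of a function considered only on the time domain J: a
   one-sided derivative at an endpoint of J belonging to J, and the usual
   derivative in the interior of J (see is_derive_withinE). *)
Definition is_derive_within (R : realType) (W : normedModType R) (J : set R)
    (f : R -> W) (t : R) (d : W) : Prop :=
  h^-1 *: (f (h + t) - f t) @[h --> within [set h | J (h + t)] 0^'] --> d.

Lemma is_derive_withinE (R : realType) (W : normedModType R) (J : set R)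
    (f : R -> W) (t : R) (d : W) : nbhs t J ->
  is_derive_within J f t d <-> is_derive t 1 f d.
Proof.
move=> Jt.
have Jt0 : \forall h \near (0 : R)^', J (h + t).
  have : \forall h \near (0 : R), (J \o shift (t - 0)) h by rewrite -near_shift.
  by rewrite subr0 => H; apply: filterS H => h Jh _.
have -> : is_derive_within J f t d <->
    (h^-1 *: ((f \o shift t) (h *: (1 : R)) - f t) @[h --> 0^'] --> d).
  have -> : (fun h : R => h^-1 *: ((f \o shift t) (h *: (1 : R)) - f t)) =
      (fun h : R => h^-1 *: (f (h + t) - f t)).
    by apply/funext => h; rewrite /= [h *: _]mulr1.
  split=> H A /H /= HA.
    by apply: (filterS2 _ _ Jt0 HA) => h /= Jh Ah; exact: Ah.
  by apply: (@filterS _ (0 : R)^' _ _ _ _ HA) => h Ah _.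
split=> [H | [df <-]]; last exact: df.
by apply: DeriveDef; [apply/cvg_ex; exists d | exact: cvg_lim H].
Qed.

Section ClosedLoop.
Variables (R : realType) (n : nat).

(* edge is the neighbor relation. Irreflexivity is not required: a self-loop
   cancels in D - A. The droop coefficients, G and B are arbitrary. *)
Record network := Network {
  edge : rel 'I_n;
  edge_sym : symmetric edge;
  edge_connected : forall i j, connect edge i j;
  tau_Omega : R; tau_Omega_gt0 : 0 < tau_Omega;
  tau_v : R; tau_v_gt0 : 0 < tau_v;
  tau_p : R; tau_p_gt0 : 0 < tau_p;
  tau_d : R; tau_d_gt0 : 0 < tau_d;
  beta : R; beta_gt0 : 0 < beta;
  gain : R; gain_gt0 : 0 < gain;
  omega_nom : R;
  m_omega : 'I_n -> R;
  S_rated : 'I_n -> R; S_rated_gt0 : forall i, 0 < S_rated i;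
  V_min : 'I_n -> R; V_min_gt0 : forall i, 0 < V_min i;
  V_max : 'I_n -> R; V_min_lt_max : forall i, V_min i < V_max i;
  G : 'M[R]_n;
  B : 'M[R]_n
}.

Record state := State {
  theta : 'cV[R]_n;
  Omega : 'cV[R]_n;
  volt : 'cV[R]_n;
  lambda : 'cV[R]_n;
  zeta : 'cV[R]_n
}.

Definition ones : 'cV[R]_n := const_mx 1.

Definition diag (d : 'I_n -> R) : 'M[R]_n := diag_mx (\row_i d i).

Variable p : network.

Definition adjacency : 'M[R]_n := \matrix_(i, j) (edge p i j)%:R.

Definition laplacian : 'M[R]_n :=
  diag (fun i => \sum_j adjacency i j) - adjacency.

Definition m_mx : 'M[R]_n := diag (m_omega p).

Definition S_mx : 'M[R]_n := diag (S_rated p).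

Definition V_star (i : 'I_n) : R := (V_max p i + V_min p i) / 2.

Definition V_star_vec : 'cV[R]_n := \col_i V_star i.

Definition V_star_mx : 'M[R]_n := diag V_star.

Definition Delta (i : 'I_n) : R := (V_max p i - V_min p i) / 2.

Definition Delta_mx : 'M[R]_n := diag Delta.

Definition rho (v : 'cV[R]_n) : 'M[R]_n :=
  diag (fun i => if `|v i 0| > 3 * Delta i then `|v i 0 / Delta i| - 3 else 0).

Definition sat (v : 'cV[R]_n) : 'cV[R]_n :=
  Delta_mx *m map_mx (@tanh R) (invmx Delta_mx *m v).

Definition f_P (th V : 'cV[R]_n) : 'cV[R]_n :=
  \col_i \sum_j V i 0 * V j 0 *
    (G p i j * cos (th i 0 - th j 0) + B p i j * sin (th i 0 - th j 0)).

Definition f_Q (th V : 'cV[R]_n) : 'cV[R]_n :=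
  \col_i \sum_j V i 0 * V j 0 *
    (G p i j * sin (th i 0 - th j 0) - B p i j * cos (th i 0 - th j 0)).

Definition voltage (x : state) : 'cV[R]_n := V_star_vec + sat (volt x).

Definition P_of (x : state) : 'cV[R]_n := f_P (theta x) (voltage x).

Definition Q_of (x : state) : 'cV[R]_n := f_Q (theta x) (voltage x).

(* dx is the time derivative of the state at a point where the state is x *)
Definition closed_loop (x dx : state) : Prop :=
  [/\ theta dx = omega_nom p *: ones + Omega x,
      tau_Omega p *: Omega dx = - Omega x - m_mx *m invmx S_mx *m P_of x,
      tau_v p *: volt dx = - (rho (volt x) *m volt x) - beta p *: sat (volt x)
        + V_star_mx *m (lambda x - invmx S_mx *m Q_of x),
      tau_p p *: lambda dx = - (gain p *: (laplacian *m lambda x))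
        - laplacian *m zeta x + (invmx S_mx *m Q_of x - lambda x)
    & tau_d p *: zeta dx = laplacian *m lambda x].

Definition is_state_derivative (J : set R) (x : R -> state) (t : R)
    (dx : state) : Prop :=
  [/\ is_derive_within J (theta \o x) t (theta dx),
      is_derive_within J (Omega \o x) t (Omega dx),
      is_derive_within J (volt \o x) t (volt dx),
      is_derive_within J (lambda \o x) t (lambda dx)
    & is_derive_within J (zeta \o x) t (zeta dx)].

Definition is_solution (J : set R) (x : R -> state) : Prop :=
  forall t, J t ->
    exists2 dx, is_state_derivative J x t dx & closed_loop (x t) dx.

Definition constant_on (J : set R) (f : R -> 'cV[R]_n) : Prop :=
  forall s t, J s -> J t -> f s = f t.

Definition is_steady_state (J : set R) (omega_syn : R) (x : R -> state) :
    Prop :=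
  [/\ is_solution J x,
      forall t, J t -> is_derive_within J (theta \o x) t (omega_syn *: ones)
    & [/\ constant_on J (Omega \o x), constant_on J (volt \o x),
          constant_on J (lambda \o x) & constant_on J (zeta \o x)]].

End ClosedLoop.

Arguments ones {R n}.

(* Main.v *)
(* Derivatives along a nondegenerate interval are unique, so the constant
   components of a steady state have zero derivative and theta' = omega_syn 1
   forces Omega to be a multiple of 1; the five equations follow. A vector in
   the kernel of the Laplacian is constant by the maximum principle on the
   connected graph, so lambda is a multiple of 1 as well. Averaging the Omega
   and lambda equations, with 1^T L = 0, identifies the two multiples. *)
Require Import Defs.
From mathcomp Require Import all_boot all_order all_algebra.
From mathcomp Require Import all_classical all_reals all_analysis.
From mathcomp Require Import lra.

Import Order.TTheory GRing.Theory Num.Theory.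
Import numFieldNormedType.Exports.

Local Open Scope classical_set_scope.
Local Open Scope ring_scope.

Section WithinDerivative.
Set Implicit Arguments.
Unset Strict Implicit.
Variables (R : realType) (W : normedModType R) (J : set R).
Hypothesis J_interval : is_interval J.
Hypothesis J_nondegenerate : exists s t : R, [/\ J s, J t & s < t].

(** Limits are unique only along a proper filter. Nondegeneracy gives a point [s] of [J] other than
    [t], and convexity keeps the segment from [t] to [s] in [J], so arbitrarily small nonzero
    increments are admissible, even at an endpoint. *)
Lemma interval_within_proper (t : R) : J t ->
  ProperFilter (within [set h | J (h + t)] (0 : R)^').
Proof.
move=> Jt.
have [s Js st] : exists2 s, J s & s != t.
  have [a [b [Ja Jb ab]]] := J_nondegenerate.
  have [at_|nat] := eqVneq a t; last by exists a.
  by exists b => //; rewrite -at_ gt_eqF.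
apply: Build_ProperFilter_ex => A.
move=> /nbhs_ballP[e /= e0 He].
have d0 : 0 < `|s - t| by rewrite normr_gt0 subr_eq0.
have ed0 : 0 < e + `|s - t| by rewrite addr_gt0.
(* This choice gives both [c <= 1], so that [t + c * (s - t)] stays between [t] and [s], and
   [c * |s - t| < e]. *)
pose c := e / (e + `|s - t|).
have c0 : 0 < c by rewrite divr_gt0.
have c1 : c <= 1 by rewrite ler_pdivrMr // mul1r lerDl ltW.
exists (c * (s - t)); apply: He.
- rewrite -ball_normE /= sub0r normrN normrM gtr0_norm // mulrAC.
  by rewrite ltr_pdivrMr // ltr_pM2l // ltrDr.
- by rewrite /= mulf_neq0 ?subr_eq0 // gt_eqF.
- rewrite /=; have [lst|lts|eqst] := ltgtP s t.
  + by apply: (J_interval Js Jt); apply/andP; split; nra.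
  + by apply: (J_interval Jt Js); apply/andP; split; nra.
  + by rewrite eqst eqxx in st.
Qed.

Lemma is_derive_within_unique (f : R -> W) (t : R) (d d' : W) : J t ->
  is_derive_within J f t d -> is_derive_within J f t d' -> d = d'.
Proof.
move=> Jt fd fd'; have ? := interval_within_proper Jt.
exact: (@cvg_unique _ (@norm_hausdorff _ W) _ _ d d' fd fd').
Qed.

Lemma is_derive_within_constant (f : R -> W) (t : R) : J t ->
  (forall s u, J s -> J u -> f s = f u) -> is_derive_within J f t 0.
Proof.
move=> Jt fc; rewrite /is_derive_within.
(* Since [f] is constant only on [J], the difference quotient is known to vanish only for increments
   staying in [J], which is what the filter sees. *)
apply: (@cvg_trans _ ((fun=> 0 : W) @ within [set h | J (h + t)] (0 : R)^')).
  apply: near_eq_cvg; apply: filterS (withinT _ _) => h /= Jh.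
  by rewrite (fc _ t Jh Jt) subrr scaler0.
exact: cvg_cst.
Qed.

End WithinDerivative.

Section Network.
Set Implicit Arguments.
Unset Strict Implicit.
Variables (R : realType) (n : nat) (p : network R n).

Lemma laplacian_mulE (v : 'cV[R]_n) (i : 'I_n) :
  (laplacian p *m v) i 0 = \sum_j (edge p i j)%:R * (v i 0 - v j 0).
Proof.
rewrite mulmxBl mul_diag_mx !mxE mulr_suml -sumrB.
by apply: eq_bigr => j _; rewrite !mxE mulrBr.
Qed.

Lemma tr_laplacian : (laplacian p)^T = laplacian p.
Proof.
rewrite linearB /= tr_diag_mx; congr (_ - _).
by apply/matrixP => i j; rewrite !mxE edge_sym.
Qed.

Lemma laplacian_ones : laplacian p *m ones = 0.
Proof.
apply/matrixP => i j; rewrite ord1 laplacian_mulE big1 ?mxE // => k _.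
by rewrite !mxE subrr mulr0.
Qed.

Lemma ones_laplacian : ones^T *m laplacian p = 0.
Proof. by rewrite -tr_laplacian -trmx_mul laplacian_ones trmx0. Qed.

Lemma laplacian_ker (v : 'cV[R]_n) : laplacian p *m v = 0 ->
  exists c, v = c *: ones.
Proof.
move=> Lv.
(* A maximal entry needs an index; for [n = 0] all vectors coincide. *)
case: (pickP 'I_n) => [i0 _|I0]; last first.
  by exists 0; apply/matrixP => i; have := I0 i.
pose i := [arg max_(k > i0) v k 0]%O.
have vmax j : v j 0 <= v i 0 by rewrite /i; case: arg_maxP => // k _; apply.
(* At a vertex where [v] is maximal, row [k] of [laplacian p *m v] is a sum of nonnegative terms
   equal to zero, so every neighbor attains the maximum too. *)
have max_nbr k l : edge p k l -> v k 0 = v i 0 -> v l 0 = v i 0.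
  move=> ekl vk; have /eqP := laplacian_mulE v k; rewrite Lv mxE eq_sym vk.
  rewrite psumr_eq0 => [|j _]; last by rewrite mulr_ge0 // subr_ge0.
  move/allP/(_ l (mem_index_enum _)) => /=.
  by rewrite ekl mul1r subr_eq0 => /eqP.
exists (v i 0); apply/matrixP => j z; rewrite ord1 !mxE mulr1.
have csym : connect_sym (edge p) by exact/sym_connect_sym/edge_sym.
(* The set of maximizers is closed under edges and contains [i], so connectedness makes it the whole
   graph. *)
have cl : fingraph.closed (edge p) [pred k | v k 0 == v i 0].
  by apply: intro_closed => // k l ekl /eqP vk; apply/eqP/(max_nbr k).
have := closed_connect cl (edge_connected p i j).
by rewrite !inE eqxx => /esym/eqP.
Qed.

(** Averaging reads off the coefficient of a multiple of [ones], because the entries of [ones] sum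
    to [n]. *)
Lemma mean_scale_ones (c : R) : (0 < n)%N ->
  n%:R^-1 * (ones^T *m (c *: ones : 'cV[R]_n)) 0 0 = c.
Proof.
move=> n0; rewrite -scalemxAr !mxE (eq_bigr (fun=> 1)); last first.
  by move=> i _; rewrite !mxE mulr1.
rewrite sumr_const card_ord mulrCA mulVf ?mulr1 //.
by rewrite pnatr_eq0 -lt0n.
Qed.

End Network.

Theorem lemma1 (R : realType) (n : nat) (n_gt0 : (0 < n)%N)
    (p : network R n)
    (J : set R) (J_interval : is_interval J)
    (J_nondegenerate : exists s t : R, [/\ J s, J t & s < t])
    (omega_syn : R) (x : R -> state R n)
    (x_steady : is_steady_state p J omega_syn x) :
  (forall t : R, J t ->
    let Obar := Omega (x t) in
    let vbar := volt (x t) in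
    let lbar := lambda (x t) in
    let zbar := zeta (x t) in
    let Vbar := V_star_vec p +
      Delta_mx p *m map_mx (@tanh R) (invmx (Delta_mx p) *m vbar) in
    let Pbar := f_P p (theta (x t)) Vbar in
    let Qbar := f_Q p (theta (x t)) Vbar in
    [/\ is_derive_within J (fun s => theta (x s)) t (omega_syn *: ones) /\
        omega_syn *: ones = omega_nom p *: ones + Obar,
        0 = - Obar - m_mx p *m invmx (S_mx p) *m Pbar,
        0 = - (rho p vbar *m vbar)
          - beta p *: (Delta_mx p *m
              map_mx (@tanh R) (invmx (Delta_mx p) *m vbar))
          + V_star_mx p *m (lbar - invmx (S_mx p) *m Qbar),
        0 = - (gain p *: (laplacian p *m lbar)) - laplacian p *m zbar
          + (invmx (S_mx p) *m Qbar - lbar)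
      & 0 = laplacian p *m lbar]) /\
  (forall m_star : R, 0 < m_star -> (forall i, m_omega p i = m_star) ->
    forall t : R, J t ->
    let Vbar := V_star_vec p +
      Delta_mx p *m map_mx (@tanh R) (invmx (Delta_mx p) *m volt (x t)) in
    let Pbar := f_P p (theta (x t)) Vbar in
    let Qbar := f_Q p (theta (x t)) Vbar in
    let alpha_P := n%:R^-1 * (ones^T *m invmx (S_mx p) *m Pbar) 0 0 in
    let alpha_Q := n%:R^-1 * (ones^T *m invmx (S_mx p) *m Qbar) 0 0 in
    Omega (x t) = - (m_star * alpha_P) *: ones /\
    lambda (x t) = alpha_Q *: ones).
Proof.
have [x_sol dtheta [cO cv cl cz]] := x_steady.
(* The derivative supplied by the solution property is pinned down by uniqueness:
   [omega_syn *: ones] for the angles, zero for the other components. *)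
have steady t : J t -> closed_loop p (x t) (State (omega_syn *: ones) 0 0 0 0).
  move=> Jt; have [[dth dO dv dl dz] [/= th' O' v' l' z'] cll] := x_sol t Jt.
  have uniq := is_derive_within_unique J_interval J_nondegenerate Jt.
  have zero (f : R -> 'cV[R]_n) d : constant_on J f -> is_derive_within J f t d -> d = 0.
    by move=> cf fd; apply: uniq fd (is_derive_within_constant Jt cf).
  move: cll; rewrite (uniq _ _ _ _ th' (dtheta t Jt)).
  by rewrite (zero _ _ cO O') (zero _ _ cv v') (zero _ _ cl l') (zero _ _ cz z').
split=> [t Jt /=|m_star _ m_eq t Jt /=].
  have [/= eth eO ev el ez] := steady t Jt.
  rewrite !scaler0 in eO ev el ez.
  by split=> //; split=> //; exact: dtheta.
have [/= eth eO _ el ez] := steady t Jt.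
rewrite !scaler0 in eO el ez.
rewrite -/(sat p (volt (x t))) -/(voltage p (x t)) -/(P_of p (x t)) -/(Q_of p (x t)).
rewrite -!mulmxA; split.
  have Oc : Omega (x t) = (omega_syn - omega_nom p) *: ones.
    by rewrite scalerBl eth addrC addKr.
  have m_scalar : m_mx p = m_star%:M.
    rewrite /m_mx /diag -diag_const_mx; congr diag_mx.
    by apply/rowP => i; rewrite !mxE m_eq.
  move: eO; rewrite m_scalar -mulmxA mul_scalar_mx Oc -scaleNr.
  move=> /esym/subr0_eq OP.
  (* Moving [m_star] inside the mean exposes the vector that [OP] equates with
     [- (omega_syn - omega_nom p) *: ones]. *)
  have -> : m_star * (n%:R^-1 * (ones^T *m (invmx (S_mx p) *m P_of p (x t))) 0 0)
      = n%:R^-1 * (ones^T *m (m_star *: (invmx (S_mx p) *m P_of p (x t)))) 0 0.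
    by rewrite -scalemxAr [in RHS]mxE mulrCA.
  by rewrite -OP mean_scale_ones // opprK.
have [c lc] := laplacian_ker (esym ez).
(* Summing the [lambda] equation over all nodes removes [zeta], as the columns of the Laplacian sum
   to zero; the gain term vanishes by [ez]. What remains equates the sums of [lambda] and of
   [invmx (S_mx p) *m Q_of p (x t)]. *)
have /(congr1 (mulmx ones^T)) := el.
rewrite -ez scaler0 oppr0 sub0r mulmx0 mulmxDr mulmxN.
rewrite (mulmxA _ (laplacian p)) ones_laplacian mul0mx oppr0 add0r mulmxBr => /esym/subr0_eq ->.
by rewrite lc mean_scale_ones.
Qed.
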